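(* Let $\beta\geq 0$ and let $p$ be an analytic function on $\mathbb{D}$ with $p(0)=1$ satisfying $$p(z)+\beta zp'(z)\prec\varphi_{CAR}(z).$$ Then $p(z)\prec\frac{1+z}{1-z}$.
   Context: $\mathbb{D}$ is the open unit disc in $\mathbb{C}$. $\varphi_{CAR}(z)=1+\frac{4z}{3}+\frac{2z^2}{3}$. For analytic functions $f,g$ on $\mathbb{D}$, $f\prec g$ ($f$ is subordinate to $g$) means there is an analytic $w:\mathbb{D}\to\mathbb{D}$ with $w(0)=0$ and $f(z)=g(w(z))$ for all $z\in\mathbb{D}$. *)

(* Defs.v *)
From Stdlib Require Import Reals.
From Coquelicot Require Import Coquelicot.

Definition unit_disc (z : C) : Prop := (Cmod z < 1)%R.

(* Only the values on the open disc matter: it is a neighbourhood of each of its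
   points, so complex differentiability there ignores values outside. *)
Definition analytic_on_disc (f : C -> C) : Prop :=
  forall z : C, unit_disc z ->
    @ex_derive C_AbsRing C_NormedModule f z.

Definition subordinate (f g : C -> C) : Prop :=
  exists w : C -> C,
    analytic_on_disc w /\
    (forall z : C, unit_disc z -> unit_disc (w z)) /\
    w (RtoC 0) = RtoC 0 /\
    (forall z : C, unit_disc z -> f z = g (w z)).

Definition phi_CAR (z : C) : C :=
  (RtoC 1 + RtoC 4 * z / RtoC 3 + RtoC 2 * (z * z) / RtoC 3)%C.

Definition half_plane_map (z : C) : C := ((RtoC 1 + z) / (RtoC 1 - z))%C.

(* Main.v *)
Require Import Defs.
From Stdlib Require Import Reals Lra.
From Coquelicot Require Import Coquelicot.

(** On the unit circle [Re (phi_CAR z) = 4/3 (Re z + 1/2)^2 >= 0], so the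
    hypothesis gives [Re (p z + beta z p' z) > 0] on the disc. Along the ray
    [t |-> t z] put [h t = Re (p (t z))]; this says [h + beta t h' > 0] on
    [[0, 1]], which fails at a minimum of [h] with [h <= 0]. Hence [Re p > 0],
    and [(p - 1) / (p + 1) = 1 - 2 / (p + 1)] is the Schwarz function. *)

(** The two module structures on the complex numbers have convertible norms and operations, so one
    error estimate serves both. The chain rule takes its inner function in the ring's own structure,
    while [analytic_on_disc] uses [C_NormedModule]. *)
Lemma is_derive_C_AbsRing (f : C -> C) (z l : C) :
  @is_derive C_AbsRing C_NormedModule f z l <->
  @is_derive C_AbsRing (AbsRing_NormedModule C_AbsRing) f z l.
Proof.
  split; intros [_ D]; (split; [apply is_linear_scal_l | exact D]).
Qed.

Lemma is_derive_C_Cmod (f : C -> C) (z l : C) :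
  @is_derive C_AbsRing C_NormedModule f z l <->
  (forall eps, 0 < eps -> exists d, 0 < d /\ forall y,
    Cmod (y - z) < d ->
    Cmod (f y - f z - (y - z) * l)%C <= eps * Cmod (y - z))%R.
Proof.
  split.
  - intros [_ D] eps Heps.
    destruct (D z (fun P H => H) (mkposreal eps Heps)) as [d Hd].
    exists d; split; [apply cond_pos | exact Hd].
  - intro D; split; [apply is_linear_scal_l |].
    intros x Hx eps.
    (* The estimate is demanded at every limit [x] of the neighbourhood filter of [z]; the only such
       limit is [z]. *)
    rewrite <- (is_filter_lim_locally_unique (V := AbsRing_NormedModule C_AbsRing) z x Hx).
    destruct (D eps (cond_pos eps)) as [d [Hd H]].
    exists (mkposreal d Hd); exact H.
Qed.

Lemma is_derive_Cinv (u : C) :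
  u <> 0%C -> @is_derive C_AbsRing C_NormedModule Cinv u (- / (u * u))%C.
Proof.
  intro Hu; apply is_derive_C_Cmod; intros eps Heps.
  assert (Hm : (0 < Cmod u)%R) by (now apply Cmod_gt_0).
  set (m := Cmod u) in *.
  (* The remainder is [(y - u)^2 / (y * u^2)]. The first bound keeps [Cmod y] above [m / 2], so the
     denominator exceeds [m^3 / 2] in modulus; the second then makes the quotient at most
     [eps * Cmod (y - u)]. *)
  exists (Rmin (m / 2) (eps * (m * m * m) / 2)).
  assert (Hm3 : (0 < m * m * m)%R) by (repeat apply Rmult_lt_0_compat; lra).
  split.
  { apply Rmin_glb_lt; [lra |]. apply Rmult_lt_0_compat; [| lra]. nra. }
  intros y Hy.
  assert (H1 := Rlt_le_trans _ _ _ Hy (Rmin_l _ _)).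
  assert (H2 := Rlt_le_trans _ _ _ Hy (Rmin_r _ _)).
  assert (Hy2 : (m / 2 < Cmod y)%R).
  { assert (T := Cmod_triangle y (u - y)%C).
    replace (y + (u - y))%C with u in T by ring.
    replace (u - y)%C with (- (y - u))%C in T by ring.
    rewrite Cmod_opp in T. fold m in T; lra. }
  assert (Hy0 : y <> 0%C) by (apply Cmod_gt_0; lra).
  replace (/ y - / u - (y - u) * - / (u * u))%C
    with ((y - u) * (y - u) / (y * (u * u)))%C by (field; auto).
  rewrite Cmod_div by (repeat apply Cmult_neq_0; auto).
  rewrite !Cmod_mult; fold m.
  apply Rle_div_l; [repeat apply Rmult_lt_0_compat; lra |].
  assert (Hd := Cmod_ge_0 (y - u)%C).
  set (d := Cmod (y - u)%C) in *.
  assert (m / 2 * (m * m) <= Cmod y * (m * m))%R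
    by (apply Rmult_le_compat_r; nra).
  replace (eps * d * (Cmod y * (m * m)))%R with (d * (eps * (Cmod y * (m * m))))%R by ring.
  apply Rmult_le_compat_l; nra.
Qed.

Lemma is_derive_Re_ray (f : C -> C) (z l : C) (t : R) :
  @is_derive C_AbsRing C_NormedModule f (t * z)%C l ->
  derivable_pt_lim (fun s => Re (f (s * z)%C)) t (Re (z * l)%C).
Proof.
  intro D; rewrite is_derive_C_Cmod in D.
  intros eps Heps.
  assert (Hz := Cmod_ge_0 z).
  (* A real step [h] moves the argument by [h * z], which costs a factor [Cmod z]. The [+ 1] covers
     [z = 0], and the 2 leaves room for the strict inequality. *)
  destruct (D (eps / (2 * (Cmod z + 1)))%R) as [d [Hd H]].
  { apply Rdiv_lt_0_compat; lra. }
  assert (Hd' : (0 < d / (Cmod z + 1))%R) by (apply Rdiv_lt_0_compat; lra).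
  exists (mkposreal _ Hd'); cbn [pos]; intros h Hh Hlt.
  assert (Hh0 := Rabs_pos_lt h Hh).
  apply Rlt_div_r in Hlt; [| lra].
  specialize (H ((t + h)%R * z)%C).
  replace ((t + h)%R * z - t * z)%C with (h * z)%C in H
    by (rewrite RtoC_plus; ring).
  rewrite Cmod_mult, Cmod_R in H.
  assert (Hs : (Rabs h * Cmod z < d)%R) by nra.
  specialize (H Hs).
  assert (HR := Rle_trans _ _ _ (re_le_Cmod _) H).
  replace ((Re (f ((t + h)%R * z)%C) - Re (f (t * z)%C)) / h - Re (z * l)%C)%R
    with (Re (f ((t + h)%R * z) - f (t * z) - h * z * l)%C / h)%R.
  2:{ unfold Re; simpl. now field. }
  rewrite Rabs_div by exact Hh.
  apply Rlt_div_l; [exact Hh0 |].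
  apply Rle_lt_trans with (1 := HR).
  replace (eps / (2 * (Cmod z + 1)) * (Rabs h * Cmod z))%R
    with (eps * Rabs h * (Cmod z / (2 * (Cmod z + 1))))%R by (field; lra).
  rewrite <- (Rmult_1_r (eps * Rabs h)) at 2.
  apply Rmult_lt_compat_l; [nra |].
  apply Rlt_div_l; lra.
Qed.

Lemma Cmod_lt_1_sqr (z : C) : (Cmod z < 1)%R <-> (Re z * Re z + Im z * Im z < 1)%R.
Proof.
  rewrite <- (sqrt_1) at 1; unfold Cmod; fold (Re z) (Im z).
  replace (Re z * Re z + Im z * Im z)%R with (Re z ^ 2 + Im z ^ 2)%R by ring.
  split; intro H; [now apply sqrt_lt_0_alt |].
  apply sqrt_lt_1_alt; split; [nra | exact H].
Qed.

Lemma Re_phi_CAR_pos (z : C) : unit_disc z -> (0 < Re (phi_CAR z))%R.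
Proof.
  unfold unit_disc; rewrite Cmod_lt_1_sqr; destruct z as [x y]; simpl; intro H.
  (* Replacing [y^2] by the larger [1 - x^2] lowers the real part to [4/3 * (x + 1/2)^2]. *)
  assert (Hx := Rle_0_sqr (x + 1 / 2)); unfold Rsqr in Hx.
  unfold phi_CAR, Re; simpl.
  match goal with |- (0 < ?e)%R =>
    replace e with (1 + 4 * x / 3 + 2 * (x * x - y * y) / 3)%R by field
  end.
  lra.
Qed.

Lemma pos_of_pos_add_derive (h dh : R -> R) (b : R) :
  (0 <= b)%R -> (0 < h 0)%R ->
  (forall t, 0 <= t <= 1 -> derivable_pt_lim h t (dh t))%R ->
  (forall t, 0 <= t <= 1 -> 0 < h t + b * t * dh t)%R ->
  (0 < h 1)%R.
Proof.
  intros Hb H0 D Hpos.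
  destruct (continuity_ab_min h 0 1 Rle_0_1) as [m [Hmin Hm]].
  { intros t Ht; apply derivable_continuous_pt; exists (dh t); now apply D. }
  apply Rlt_le_trans with (h m); [| apply Hmin; lra].
  destruct (Rlt_le_dec 0 (h m)) as [Hhm | Hhm]; [exact Hhm | exfalso].
  assert (Hm0 : (0 < m)%R).
  { destruct (proj1 Hm) as [|E]; [assumption | subst m; lra]. }
  assert (Hd : (dh m <= 0)%R).
  { apply Rnot_lt_le; intro Hd.
    destruct (D m Hm (dh m) Hd) as [d H].
    (* The minimum may sit at the endpoint 1, so only a left difference quotient is used: [k <= m]
       keeps [m - k] in the interval and [k <= d / 2] makes the quotient positive, against
       minimality. *)
    set (k := Rmin (d / 2) m).
    assert (Hdp := cond_pos d).
    assert (Hk : (0 < k)%R) by (apply Rmin_glb_lt; lra).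
    assert (Hk1 : (k <= d / 2)%R) by apply Rmin_l.
    assert (Hk2 : (k <= m)%R) by apply Rmin_r.
    specialize (H (- k)%R).
    rewrite Rabs_Ropp, Rabs_pos_eq in H by lra.
    specialize (H ltac:(lra) ltac:(lra)).
    apply Rabs_def2 in H.
    assert (Hq : (0 < (h (m + - k) - h m) / - k)%R) by lra.
    assert (Hle := Hmin (m + - k)%R ltac:(lra)).
    replace ((h (m + - k) - h m) / - k)%R
      with (- ((h (m + - k) - h m) / k))%R in Hq by (field; lra).
    assert (0 <= (h (m + - k) - h m) / k)%R by (apply Rdiv_le_0_compat; lra).
    lra. }
  assert (Hc := Hpos m Hm).
  assert (0 <= b * m)%R by (apply Rmult_le_pos; lra).
  nra.
Qed.

Theorem theorem3p7 :
  forall (beta : R) (p : C -> C),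
    (0 <= beta)%R ->
    analytic_on_disc p ->
    p (RtoC 0) = RtoC 1 ->
    subordinate (fun z : C => (p z + RtoC beta * z * C_derive p z)%C) phi_CAR ->
    subordinate p half_plane_map.
Proof.
  intros beta p Hbeta Hp Hp0 [w [_ [Hw [_ Heq]]]].
  assert (Hpos : forall z, unit_disc z -> (0 < Re (p z))%R).
  { intros z Hz.
    assert (Hray : forall t, (0 <= t <= 1)%R -> unit_disc (t * z)).
    { intros t Ht; unfold unit_disc in *.
      rewrite Cmod_mult, Cmod_R, Rabs_pos_eq by lra.
      assert (H := Cmod_ge_0 z); nra. }
    (* This exhibits the goal as the value at [t = 1] of the function on the ray. *)
    rewrite <- (Cmult_1_l z).
    apply (pos_of_pos_add_derive (fun t => Re (p (t * z)%C))
      (fun t => Re (z * C_derive p (t * z))%C) beta); [exact Hbeta | | |].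
    - rewrite Cmult_0_l, Hp0; exact Rlt_0_1.
    - intros t Ht; apply is_derive_Re_ray, C_derive_correct; [exact 0%C|].
      now apply Hp, Hray.
    - intros t Ht.
      assert (H := Re_phi_CAR_pos _ (Hw _ (Hray t Ht))).
      rewrite <- (Heq _ (Hray t Ht)) in H.
      replace (Re (p (t * z)%C) + beta * t * Re (z * C_derive p (t * z))%C)%R
        with (Re (p (t * z) + beta * (t * z) * C_derive p (t * z))%C); [exact H|].
      unfold Re; simpl; ring. }
  assert (Hne : forall z, unit_disc z -> (p z + 1)%C <> 0%C).
  { intros z Hz E; apply (f_equal Re) in E.
    assert (H := Hpos z Hz). unfold Re in *; simpl in E; lra. }
  (* The constant 2 stands on the right so that the product reads as a scalar function acting on a
     fixed vector, the shape of [ex_derive_scal_l]. *)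
  exists (fun z => (1 - / (p z + 1) * 2)%C).
  split; [| split; [| split]].
  - intros z Hz.
    assert (Dq : @ex_derive C_AbsRing (AbsRing_NormedModule C_AbsRing)
                   (fun y => (p y + 1)%C) z).
    { apply (ex_derive_plus (V := AbsRing_NormedModule C_AbsRing) p (fun _ => RtoC 1)).
      - destruct (Hp z Hz) as [l Hl]; exists l; now apply is_derive_C_AbsRing.
      - apply ex_derive_const. }
    apply (ex_derive_minus (V := C_NormedModule) (fun _ => RtoC 1)
             (fun y => (/ (p y + 1) * 2)%C)); [apply ex_derive_const |].
    apply (ex_derive_scal_l (V := C_NormedModule) (fun y => (/ (p y + 1))%C)).
    apply (ex_derive_comp (V := AbsRing_NormedModule C_AbsRing) Cinv
             (fun y => (p y + 1)%C)); [| exact Dq].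
    eexists; apply is_derive_C_AbsRing, is_derive_Cinv; auto.
  - intros z Hz; unfold unit_disc.
    replace (1 - / (p z + 1) * 2)%C with ((p z - 1) / (p z + 1))%C
      by (field; auto).
    rewrite Cmod_div by auto.
    apply Rlt_div_l; [apply Cmod_gt_0; auto |].
    rewrite Rmult_1_l.
    assert (H := Hpos z Hz); destruct (p z) as [x y].
    unfold Re in H; simpl in H.
    (* The squared moduli of [p z + 1] and [p z - 1] differ by [4 * x], which is positive. *)
    unfold Cmod; simpl; apply sqrt_lt_1_alt; split; [| lra].
    apply Rplus_le_le_0_compat; apply pow2_ge_0.
  - rewrite Hp0; field.
  - intros z Hz; unfold half_plane_map.
    (* The denominator of [half_plane_map] at the witness is [2 / (p z + 1)], so it is nonzero
       because 2 is. *)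
    assert (H2 : (2 : C) <> 0%C) by (intro E; apply RtoC_inj in E; lra).
    field; split; [now auto |].
    now replace (p z + 1 - (p z + 1 - 2))%C with (RtoC 2) by ring.
Qed.
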